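(* Suppose that $\inf_{x\in X} f_i(x)>-\infty$ for $i=1,\dots,m$, and that at least one of the functions $f_i$ is coercive. Then $\mathbf{f}\Box\iota_\Delta$ is proper, lower semicontinuous and convex, and exact on $\mathbf{X}$.
   Context: $X$ is a real Hilbert space, $m\in\{1,2,\dots\}$, $\mathbf{X}=X^m$ is the product Hilbert space, $\Delta=\{(x,\dots,x):x\in X\}$ with orthogonal complement $\Delta^\perp$. $f_1,\dots,f_m$ are proper lower semicontinuous convex functions $X\to\,]-\infty,+\infty]$ and $\mathbf{f}(x_1,\dots,x_m)=\sum_{i=1}^m f_i(x_i)$. $\iota_\Delta$ is the indicator function of $\Delta$; $(\mathbf{f}\Box\iota_\Delta)(\mathbf{x})=\inf_{\mathbf{u}\in\mathbf{X}}(\mathbf{f}(\mathbf{u})+\iota_\Delta(\mathbf{x}-\mathbf{u}))$, and it is exact at $\mathbf{x}$ if this infimum is attained (exact on $\mathbf{X}$: at every point). A function $g$ is coercive if $g(x)\to+\infty$ as $\|x\|\to\infty$. Standing assumption: $\operatorname{dom}\mathbf{f}^*\cap\Delta^\perp\neq\varnothing$ ($\mathbf{f}^*$ the Fenchel conjugate). *)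

(* Defs.v *)
From HB Require Import structures.
From mathcomp Require Import all_boot all_order all_algebra.
From mathcomp Require Import all_classical all_reals all_analysis.
From mathcomp Require Import ring lra.

Set Implicit Arguments.
Unset Strict Implicit.
Unset Printing Implicit Defensive.

Import Order.TTheory GRing.Theory Num.Theory.
Import numFieldNormedType.Exports.

Local Open Scope classical_set_scope.
Local Open Scope ring_scope.

(* Positive definiteness of the inner product is a consequence of [innerE]. *)
HB.mixin Record NormedModule_hasInner (R : realType) V & NormedModule R V := {
  inner : V -> V -> R ;
  innerC : forall x y, inner x y = inner y x ;
  innerDl : forall x y z, inner (x + y) z = inner x z + inner y z ;
  innerZl : forall (a : R) x y, inner (a *: x) y = a * inner x y ;
  innerE : forall x, inner x x = `|x| ^+ 2
}.

#[short(type="hilbertType")]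
HB.structure Definition Hilbert (R : realType) :=
  {V of NormedModule_hasInner R V & CompleteNormedModule R V}.

Definition hpower (m : nat) (X : Type) : Type := {ffun 'I_m -> X}.

Section hpower.
Context (R : realType) (X : hilbertType R) (m : nat).

HB.instance Definition _ := GRing.Lmodule.copy (hpower m X) {ffun 'I_m -> X}.

Implicit Types x y z : hpower m X.

Definition hpower_inner x y : R := \sum_i inner (x i) (y i).

Definition hpower_norm x : R := Num.sqrt (hpower_inner x x).

Lemma hpower_innerC x y : hpower_inner x y = hpower_inner y x.
Proof. by apply: eq_bigr => i _; rewrite innerC. Qed.

Lemma hpower_innerDl x y z :
  hpower_inner (x + y) z = hpower_inner x z + hpower_inner y z.
Proof. by rewrite -big_split; apply: eq_bigr => i _; rewrite ffunE innerDl. Qed.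

Lemma hpower_innerZl (a : R) x y :
  hpower_inner (a *: x) y = a * hpower_inner x y.
Proof. by rewrite mulr_sumr; apply: eq_bigr => i _; rewrite ffunE innerZl. Qed.

Lemma hpower_inner_ge0 x : 0 <= hpower_inner x x.
Proof. by apply: sumr_ge0 => i _; rewrite innerE sqr_ge0. Qed.

Lemma hpower_norm_sqr x : hpower_norm x ^+ 2 = hpower_inner x x.
Proof. by rewrite sqr_sqrtr ?hpower_inner_ge0. Qed.

Lemma hpower_inner_le x y :
  hpower_inner x y <= hpower_norm x * hpower_norm y.
Proof.
set a := hpower_norm x; set b := hpower_norm y.
have a0 : 0 <= a by exact: sqrtr_ge0.
have b0 : 0 <= b by exact: sqrtr_ge0.
have expand (s t : R) : 0 <= s ^+ 2 * a ^+ 2 + t ^+ 2 * b ^+ 2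
    + 2 * (s * t) * hpower_inner x y.
  have := hpower_inner_ge0 (s *: x + t *: y).
  rewrite hpower_innerDl !hpower_innerZl !(hpower_innerC _ (_ + _)).
  rewrite !hpower_innerDl !hpower_innerZl -!hpower_norm_sqr -/a -/b.
  by rewrite (hpower_innerC y x) => h; nra.
have [ab0|ab0] := eqVneq (a * b) 0.
  have : a = 0 \/ b = 0.
    by move/eqP: ab0; rewrite mulf_eq0 => /orP[] /eqP; [left|right].
  rewrite ab0 => -[z0|z0].
  - rewrite leNgt; apply/negP => c0.
    have := expand (- (b ^+ 2 / hpower_inner x y)) 1.
    rewrite z0 expr0n mulr0 add0r expr1n mul1r mulr1 -mulrA mulNr mulfVK ?gt_eqF//.
    move=> h; have bb : b ^+ 2 = 0 by apply/eqP; rewrite eq_le sqr_ge0 andbT; lra.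
    have := expand (-1) 1; rewrite z0 bb; lra.
  - rewrite leNgt; apply/negP => c0.
    have := expand 1 (- (a ^+ 2 / hpower_inner x y)).
    rewrite z0 expr0n mulr0 addr0 expr1n !mul1r -mulrA mulNr mulfVK ?gt_eqF//.
    move=> h; have aa : a ^+ 2 = 0 by apply/eqP; rewrite eq_le sqr_ge0 andbT; lra.
    have := expand 1 (-1); rewrite z0 aa; lra.
have ab : 0 < a * b by rewrite lt_neqAle eq_sym ab0 mulr_ge0.
have := expand b (- a) => h.
have : 0 <= (a * b) * (a * b - hpower_inner x y) by nra.
by rewrite pmulr_rge0// subr_ge0.
Qed.

Lemma hpower_ler_normD x y :
  hpower_norm (x + y) <= hpower_norm x + hpower_norm y.
Proof.
rewrite -(@ler_pXn2r _ 2)// ?nnegrE ?addr_ge0 ?sqrtr_ge0//.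
rewrite sqrrD !hpower_norm_sqr hpower_innerDl !(hpower_innerC _ (_ + _)).
rewrite !hpower_innerDl (hpower_innerC y x).
have := hpower_inner_le x y; lra.
Qed.

Lemma hpower_normZ (a : R) x : hpower_norm (a *: x) = `|a| * hpower_norm x.
Proof.
rewrite /hpower_norm hpower_innerZl hpower_innerC hpower_innerZl mulrA -expr2.
by rewrite sqrtrM ?sqr_ge0// sqrtr_sqr.
Qed.

Lemma hpower_le_norm x i : `|x i| <= hpower_norm x.
Proof.
rewrite -(@ler_pXn2r _ 2)// ?nnegrE ?sqrtr_ge0// hpower_norm_sqr.
rewrite /hpower_inner (bigD1 i)//= innerE lerDl.
by apply: sumr_ge0 => j _; rewrite innerE sqr_ge0.
Qed.

Lemma hpower_norm_eq0 x : hpower_norm x = 0 -> x = 0.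
Proof.
move=> x0; apply/ffunP => i; rewrite [RHS]ffunE.
by apply/normr0_eq0/eqP; rewrite eq_le normr_ge0 andbT -x0 hpower_le_norm.
Qed.

HB.instance Definition _ := Lmodule_isNormed.Build R (hpower m X)
  hpower_ler_normD hpower_normZ hpower_norm_eq0.

Lemma hpower_innerE x : hpower_inner x x = `|x| ^+ 2.
Proof. by rewrite -hpower_norm_sqr. Qed.

Lemma hpower_norm_le x (e : R) : 0 <= e ->
  (forall i, `|x i| <= e) -> `|x| <= Num.sqrt m%:R * e.
Proof.
move=> e0 xe.
rewrite -(@ler_pXn2r _ 2)// ?nnegrE ?mulr_ge0 ?sqrtr_ge0//.
rewrite -hpower_innerE exprMn sqr_sqrtr ?ler0n//.
have -> : m%:R * e ^+ 2 = \sum_(i < m) e ^+ 2.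
  by rewrite sumr_const card_ord mulr_natl.
by apply: ler_sum => i _; rewrite innerE lerXn2r// nnegrE.
Qed.

Lemma hpower_complete (F : set_system (hpower m X)) :
  ProperFilter F -> cauchy F -> cvg F.
Proof.
move=> FF Fc.
have Fi (i : 'I_m) : cvg ((fun x : hpower m X => x i) @ F).
  apply: cauchy_cvg; apply/cauchy_ballP => e e0.
  have /cauchy_ballP /(_ e e0) [[A B] [/= FA FB] AB] := Fc.
  exists ((fun x : hpower m X => x i) @` A, (fun x : hpower m X => x i) @` B).
    by split=> /=; [apply: filterS FA | apply: filterS FB] => x ?; exists x.
  move=> [_ _] /= [[x Ax <-] [y By <-]].
  have := AB (x, y) (conj Ax By); rewrite -!ball_normE /=.
  apply: le_lt_trans.
  by have := hpower_le_norm (x - y) i; rewrite !ffunE.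
apply/cvg_ex; exists ([ffun i => lim ((fun x : hpower m X => x i) @ F)]).
apply/cvgrPdist_le => e e0.
pose d := e / (Num.sqrt m%:R + 1).
have s0 : 0 <= Num.sqrt m%:R :> R by exact: sqrtr_ge0.
have d0 : 0 < d by rewrite divr_gt0// ltr_wpDl.
have H : \forall x0 \near F, let x : hpower m X := x0 in forall i : 'I_m,
    `|lim ((fun x : hpower m X => x i) @ F) - x i| <= d.
  apply: filter_forall => i.
  by have /cvgrPdist_le /(_ d d0) := Fi i.
apply: filterS H => x xd.
apply: (@le_trans _ _ (Num.sqrt m%:R * d)).
  by apply: hpower_norm_le; [exact: ltW | move=> i; rewrite !ffunE; exact: xd].
by rewrite mulrCA ger_pMr// ler_pdivrMr ?mul1r ?lerDl// ltr_wpDl.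
Qed.

HB.instance Definition _ := Uniform_isComplete.Build (hpower m X)
  hpower_complete.

HB.instance Definition _ := NormedModule_hasInner.Build R (hpower m X)
  hpower_innerC hpower_innerDl hpower_innerZl hpower_innerE.

End hpower.

Section convex_analysis.
Context {R : realType} {E : hilbertType R}.
Implicit Types (f g : E -> \bar R) (C : set E) (x y u v : E).

Local Open Scope ereal_scope.

Definition edom f : set E := [set x | f x < +oo].

Definition proper_efun f := (forall x, f x != -oo) /\ edom f !=set0.

(* Only used together with [proper_efun]: at points where [f] takes both values
   [-oo] and [+oo] the right-hand side is [-oo + +oo], which is [-oo] here. *)
Definition convex_efun f := forall x y (t : R), (0 < t < 1)%R ->
  f (t *: x + (1 - t) *: y)%R <= t%:E * f x + (1 - t)%:E * f y.

(* The filter base is that of neighborhoods of infinity in norm. *)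
Definition coercive_efun f :=
  f @ filter_from setT (fun r : R => [set x : E | (r < `|x|)%R]) --> +oo.

Definition fenchel_conjugate f u :=
  ereal_sup (range (fun x => (inner x u)%:E - f x)).

Definition orthogonal_compl C : set E :=
  [set v | forall x, C x -> inner x v = 0%R].

Definition indicator_efun C x : \bar R := if x \in C then 0 else +oo.

Definition inf_conv f g x := ereal_inf (range (fun u => f u + g (x - u)%R)).

Definition exact_at f g x := exists u, inf_conv f g x = f u + g (x - u)%R.

End convex_analysis.

Section product_space.
Context {R : realType} {X : hilbertType R} {m : nat}.

Definition diagonal_space : set (hpower m X) :=
  range (fun x : X => [ffun=> x] : hpower m X).

Definition separable_sum (f : 'I_m -> X -> \bar R) (x : hpower m X) : \bar R :=
  (\sum_(i < m) f i (x i))%E.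

End product_space.

(* Main.v *)
Require Import Defs.
From HB Require Import structures.
From mathcomp Require Import all_boot all_order all_algebra.
From mathcomp Require Import all_classical all_reals all_analysis.
From mathcomp Require Import ring lra.

Import Order.TTheory GRing.Theory Num.Theory.
Import numFieldNormedType.Exports.

Local Open Scope classical_set_scope.
Local Open Scope ring_scope.

(** Write [F] for the separable sum and [D] for the indicator of the diagonal.
    The value of [inf_conv F D] at [x] is the infimum over [c] in [X] of the sum
    of the [f i (x i - c)]. If this sum is at most [a], then, all the functions
    being bounded below, the one that is coercive is bounded above at
    [x i - c], so [c] is confined to a bounded set, and this uniformly when [x]
    stays in a ball ([separable_conv_bounded]).

    A minimizer is then obtained by compactness. In infinite dimension closed
    balls are only weakly compact, but the weak topology can be avoided, because
    all sublevel sets in sight are convex: in a Hilbert space, a decreasing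
    sequence of nonempty bounded convex sets has a common adherent point
    ([bigcap_closure_neq0]). This is seen by choosing in each set a point of
    almost minimal norm: the parallelogram identity makes these points a Cauchy
    sequence, as in the existence proof of the projection onto a convex set.

    For two convex lower semicontinuous functions [f] and [g], apply this to the
    sets of those [u] such that [f u + g (x' - u) <= a + 1 / n.+1] for some [x']
    within [1 / n.+1] of [x]. Lower semicontinuity gives
    [f u + g (x - u) <= a] at a common adherent point [u]
    ([conv_attained_of_approx]). Letting the base point [x'] vary is what makes
    this single statement yield both conclusions: exactness with [x' = x] and
    [a] the value of the infimum ([inf_conv_exact]), lower semicontinuity with
    [x'] ranging over points near [x] where the infimal convolution is at most
    [a] ([inf_conv_lsc]). Convexity is immediate from exactness, and properness
    from the lower bounds on the [f i]. *)

(** * Decreasing sequences of bounded convex sets in a Hilbert space *)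

Section hilbert.
Context {R : realType} {E : hilbertType R}.
Implicit Types x y : E.

Lemma sqr_normD x y : `|x + y| ^+ 2 = `|x| ^+ 2 + 2 * inner x y + `|y| ^+ 2.
Proof.
rewrite -!innerE innerDl (innerC x (x + y)) (innerC y (x + y)) !innerDl.
by rewrite (innerC y x); ring.
Qed.

Lemma parallelogram x y :
  `|x + y| ^+ 2 + `|x - y| ^+ 2 = 2 * (`|x| ^+ 2 + `|y| ^+ 2).
Proof.
rewrite !sqr_normD normrN (innerC x (- y)) -scaleN1r innerZl (innerC y x).
by ring.
Qed.

(** Points of [S n] whose squared norm nearly realizes the infimum [q n] form a
    Cauchy sequence: for [n <= k] the midpoint of the [n]th and the [k]th point
    lies in [S n], so its squared norm is at least [q n], and the parallelogram
    identity bounds the distance of the two points in terms of [q k - q n],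
    which is small because [q] is nondecreasing and bounded. The limit adheres
    to every [S n]. *)
Lemma bigcap_closure_neq0 (S : (set E)^nat) (B : R) :
  (forall n, S n !=set0) -> (forall n k, (n <= k)%N -> S k `<=` S n) ->
  (forall n x y, S n x -> S n y -> S n (2^-1 *: (x + y))) ->
  (forall x, S 0 x -> `|x| <= B) ->
  \bigcap_n closure (S n) !=set0.
Proof.
move=> S0 Sdecr Smid SB.
pose N2 n : set R := (fun x => `|x| ^+ 2) @` S n.
pose q n := inf (N2 n).
have N2inf n : has_inf (N2 n).
  split; first by have [x Sx] := S0 n; exists (`|x| ^+ 2); exists x.
  by exists 0 => _ [x _ <-]; exact: sqr_ge0.
have qlb n x : S n x -> q n <= `|x| ^+ 2.
  by move=> Sx; apply: (ge_inf (N2inf n).2); exists x.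
have /choice[y yS] n : exists y, S n y /\ `|y| ^+ 2 < q n + n.+1%:R^-1.
  have [||_ [y Sy <-] lty] := @inf_adherent _ (N2 n) n.+1%:R^-1; last by exists y.
    by rewrite invr_gt0.
  exact: N2inf.
have qnd : nondecreasing_seq q.
  move=> n k nk; apply: lb_le_inf; first exact: (N2inf k).1.
  by move=> _ [x Sx <-]; apply: qlb; exact: Sdecr Sx.
have qB n : q n <= B ^+ 2.
  have [x Sx] := S0 n; apply: (le_trans (qlb _ _ Sx)).
  have xB : `|x| <= B by apply: SB; exact: Sdecr Sx.
  by rewrite lerXn2r// nnegrE ?normr_ge0// (le_trans (normr_ge0 x)).
have qcvg : cvgn q.
  by apply: nondecreasing_is_cvgn => //; exists (B ^+ 2) => _ [n _ <-].
have gap n k : (n <= k)%N ->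
    `|y n - y k| ^+ 2 <= 2 * (limn q - q n) + 4 * n.+1%:R^-1.
  move=> nk; have [Syn yn] := yS n; have [Syk yk] := yS k.
  have := qlb _ _ (Smid n _ _ Syn (Sdecr _ _ nk _ Syk)).
  rewrite normrZ exprMn ger0_norm ?invr_ge0//.
  rewrite (_ : 2^-1 ^+ 2 = 4^-1 :> R) => [mid|]; last by field.
  have ql : q k <= limn q by exact: nondecreasing_cvgn_le.
  have kn : k.+1%:R^-1 <= n.+1%:R^-1 :> R by rewrite lef_pV2 ?posrE// ler_nat.
  move: kn yn yk mid ql (parallelogram (y n) (y k)).
  move: n.+1%:R^-1 k.+1%:R^-1 (q n) (q k) (limn q) => a b c d l.
  by move: (`|_| ^+ 2) (`|_| ^+ 2) (`|_| ^+ 2) (`|_| ^+ 2) => ? ? ? ?; lra.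
have ycauchy : cauchy (y @ \oo).
  apply: cauchy_exP => e e0.
  (* By [gap], two errors below [e ^+ 2 / 8] give a squared distance below
     [6 / 8 * e ^+ 2]. *)
  have d0 : 0 < e ^+ 2 / 8 by rewrite divr_gt0// exprn_gt0.
  have [N [qN SN]] : exists N, limn q - q N < e ^+ 2 / 8 /\
      N.+1%:R^-1 < e ^+ 2 / 8.
    near \oo => N; exists N; split.
      have lq : `|limn q - q N| < e ^+ 2 / 8.
        by near: N; move/cvgrPdist_lt: qcvg; apply.
      by rewrite (le_lt_trans _ lq)// ler_norm.
    by near: N; exact: (near_infty_natSinv_lt (PosNum d0)).
  exists (y N); exists N => // k /= Nk; rewrite -ball_normE /=.
  rewrite -(@ltr_pXn2r _ 2)// ?nnegrE ?(ltW e0)//.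
  apply: (le_lt_trans (gap _ _ Nk)).
  by move: qN SN d0; move: N.+1%:R^-1 (limn q) (q N) => ? ? ?; lra.
have /cvg_ex[/= l yl] : cvg (y @ \oo) by exact: cauchy_cvg.
exists l => n _ U lU; have [k _ Uk] := yl _ lU.
exists (y (maxn n k)); split; last by apply: Uk; rewrite /= leq_maxr.
by apply: Sdecr (yS _).1; rewrite leq_maxl.
Unshelve. all: by end_near. Qed.

End hilbert.

(** * Infimal convolution under uniformly bounded sublevel sets *)

(** Reduces lower semicontinuity of a sum to that of its terms, with a strict
    inequality [r < s + t] that leaves room for perturbing [r]. *)
Lemma lt_adde_split {R : realType} (a b : \bar R) (r : R) :
  (a != -oo -> b != -oo -> r%:E < a + b ->
  exists s t : R, [/\ s%:E < a, t%:E < b & (r < s + t)%R])%E.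
Proof.
case: a => [a| |]; case: b => [b| |] //= _ _.
- rewrite -EFinD lte_fin => rab.
  exists (a - (a + b - r) / 4), (b - (a + b - r) / 4).
  by rewrite !lte_fin; split; lra.
- move=> _; exists (a - 1), (r - (a - 1) + 1).
  by rewrite ltry lte_fin; split=> //; lra.
- move=> _; exists (r - (b - 1) + 1), (b - 1).
  by rewrite ltry lte_fin; split=> //; lra.
- by move=> _; exists (r + 1), 0; rewrite !ltry; split=> //; lra.
Qed.

Lemma inf_conv_le {R : realType} {E : hilbertType R} (f g : E -> \bar R)
    (x u : E) :
  (inf_conv f g x <= f u + g (x - u)%R)%E.
Proof. by apply: ereal_inf_lbound; exists u. Qed.

Section infimal_convolution.
Context {R : realType} {E : hilbertType R} (f g : E -> \bar R).
Hypotheses (f_fin : forall x, f x != -oo%E) (g_fin : forall x, g x != -oo%E).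
Hypotheses (f_conv : convex_efun f) (g_conv : convex_efun g).

(** Joint convexity of [(x, u) |-> f u + g (x - u)]: infimal convolution is
    partial minimization of this function in [u]. *)
Lemma convex_conv_term (x y u v : E) (t : R) : 0 < t < 1 ->
  (f (t *: u + (1 - t) *: v)%R
     + g (t *: x + (1 - t) *: y - (t *: u + (1 - t) *: v))%R <=
   t%:E * (f u + g (x - u)%R) + (1 - t)%:E * (f v + g (y - v)%R))%E.
Proof.
move=> t01.
have -> : t *: x + (1 - t) *: y - (t *: u + (1 - t) *: v)
    = t *: (x - u) + (1 - t) *: (y - v).
  by rewrite !scalerBr opprD addrACA.
have fg_def a b : (f a +? g b)%E.
  by apply: ltninfty_adde_def; rewrite inE ltNye.
rewrite (muleDr _ (fg_def u _))// (muleDr _ (fg_def v _))// addeACA.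
by apply: leeD; [exact: f_conv | exact: g_conv].
Qed.

Hypotheses (f_lsc : lower_semicontinuous f) (g_lsc : lower_semicontinuous g).
(* The bound is uniform for [x'] near [x], so that it survives perturbing the
   point at which the infimal convolution is evaluated. *)
Hypothesis bnd : forall (x : E) (a : R), exists B : R, forall x' u : E,
  `|x - x'| < 1 -> (f u + g (x' - u)%R <= a%:E)%E -> `|u| <= B.

(** The approximate solutions at accuracy [1 / n.+1] form a decreasing sequence
    of convex sets, bounded by [bnd]; by joint lower semicontinuity of
    [(x', u) |-> f u + g (x' - u)] a common adherent point is an exact
    solution. *)
Lemma conv_attained_of_approx (x : E) (a : R) :
  (forall e : R, 0 < e -> exists x' u : E,
     `|x - x'| < e /\ (f u + g (x' - u)%R <= (a + e)%:E)%E) ->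
  exists u, (f u + g (x - u)%R <= a%:E)%E.
Proof.
move=> approx.
pose S n : set E := [set u | exists x' : E, `|x - x'| < n.+1%:R^-1 /\
  (f u + g (x' - u)%R <= (a + n.+1%:R^-1)%:E)%E].
have [B xB] := bnd x (a + 1).
have [||||u uS] := @bigcap_closure_neq0 _ _ S B.
- move=> n; have [|x' [u xu]] := approx n.+1%:R^-1; first by rewrite invr_gt0.
  by exists u, x'.
- move=> n k nk u [x' [xx' fg]].
  have kn : k.+1%:R^-1 <= n.+1%:R^-1 :> R by rewrite lef_pV2 ?posrE// ler_nat.
  exists x'; split; first exact: lt_le_trans kn.
  by apply: le_trans fg _; rewrite lee_fin lerD2l.
- move=> n u v [x' [xx' fgu]] [y' [xy' fgv]].
  have t01 : 0 < (2^-1 : R) < 1 by lra.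
  have half : 1 - 2^-1 = 2^-1 :> R by field.
  have := convex_conv_term x' y' u v _ t01; rewrite half -!scalerDr => fg.
  exists (2^-1 *: (x' + y')); split.
    have -> : x - 2^-1 *: (x' + y') = 2^-1 *: ((x - x') + (x - y')).
      rewrite addrACA -opprD scalerBr; congr (_ - _).
      by rewrite -[x + x]mulr2n -(scaler_nat 2 x) scalerA mulVf// scale1r.
    rewrite normrZ ger0_norm ?invr_ge0//.
    have := ler_normD (x - x') (x - y').
    by move: `|x - x' + _| `|x - x'| `|x - y'| n.+1%:R^-1 xx' xy' => ? ? ? ?; lra.
  apply: (le_trans fg).
  set b := (a + n.+1%:R^-1)%:E in fgu fgv *.
  apply: (@le_trans _ _ (2^-1%:E * b + 2^-1%:E * b)%E).
    by rewrite leeD// lee_pmul2l.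
  rewrite /b -!EFinM -EFinD lee_fin.
  by move: n.+1%:R^-1 => ?; lra.
- by move=> u [x' []]; rewrite invr1; exact: xB.
exists u; rewrite leNgt; apply/negP.
move=> /(lt_adde_split _ _ _ (f_fin _) (g_fin _))[s [t [fs gt ast]]].
have [V /nbhs_ballP[e1 /= e10 e1V] fV] := f_lsc _ _ fs.
have [W /nbhs_ballP[e2 /= e20 e2W] gW] := g_lsc _ _ gt.
(* [x' - v] must be within [e2] of [x - u]; [x'] and [v] get half of it each. *)
have d0 : 0 < Num.min (s + t - a) (e2 / 2) by rewrite lt_min subr_gt0 ast divr_gt0.
have [n] : exists n, n.+1%:R^-1 < Num.min (s + t - a) (e2 / 2).
  near \oo => n; exists n; near: n; exact: (near_infty_natSinv_lt (PosNum d0)).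
rewrite lt_min => /andP[nst ne2].
have d'0 : 0 < Num.min e1 (e2 / 2) by rewrite lt_min e10 divr_gt0.
have [v [[x' [xx' fg]]]] := uS n I _ (nbhsx_ballx u _ d'0).
rewrite -ball_normE /= lt_min => /andP[uv1 uv2].
have fv : (s%:E < f v)%E by apply/fV/e1V; rewrite -ball_normE.
have gv : (t%:E < g (x' - v)%R)%E.
  apply/gW/e2W; rewrite -ball_normE /=.
  have -> : x - u - (x' - v) = (x - x') - (u - v).
    by rewrite !opprB [LHS]addrACA [RHS]addrACA (addrC (- x')).
  apply: (le_lt_trans (ler_normB _ _)).
  by rewrite (splitr e2) ltrD// (lt_trans xx').
have := lt_le_trans (lteD fv gv) fg; rewrite -EFinD lte_fin.
by move: nst; move: n.+1%:R^-1 => ?; lra.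
Unshelve. all: by end_near.
Qed.

Lemma inf_conv_exact (x : E) : inf_conv f g x != -oo%E -> exact_at f g x.
Proof.
case fgx : (inf_conv f g x) => [a| |] // _; rewrite /exact_at fgx; last first.
  (* The infimum is [+oo], so every term is, and any [u] will do. *)
  exists 0; apply/esym/eqP; rewrite -leye_eq -fgx; exact: inf_conv_le.
have [|u ua] := @conv_attained_of_approx x a; last first.
  by exists u; apply/eqP; rewrite eq_le ua -fgx inf_conv_le.
move=> e e0; exists x.
have : (inf_conv f g x < (a + e)%:E)%E by rewrite fgx lte_fin ltrDl.
move=> /ereal_inf_lt[_ [u _ <-] /ltW fgu]; exists u; split => //.
by rewrite subrr normr0.
Qed.

Lemma inf_conv_lsc : lower_semicontinuous (inf_conv f g).
Proof.
move=> x a ax; apply: contrapT => nV.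
have [|u ua] := @conv_attained_of_approx x a; last first.
  by move: ax; rewrite ltNge (le_trans (inf_conv_le f g x u)).
move=> e e0; apply: contrapT => nx; apply: nV.
exists (ball x e); first exact: nbhsx_ballx.
move=> x'; rewrite -ball_normE /= => xx'; rewrite ltNge; apply/negP => x'a.
have : (inf_conv f g x' < (a + e)%:E)%E.
  by apply: le_lt_trans x'a _; rewrite lte_fin ltrDl.
move=> /ereal_inf_lt[_ [u _ <-] /ltW fgu].
by apply: nx; exists x', u.
Qed.

Lemma inf_conv_convex : (forall x, inf_conv f g x != -oo%E) ->
  convex_efun (inf_conv f g).
Proof.
move=> fgN x y t t01.
have [u ->] := inf_conv_exact _ (fgN x).
have [v ->] := inf_conv_exact _ (fgN y).
exact: le_trans (inf_conv_le _ _ _ _) (convex_conv_term _ _ _ _ _ t01).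
Qed.

End infimal_convolution.

(** * Finite sums and indicator functions *)

Lemma sume_neNy {R : realType} {I : Type} (r : seq I) (h : I -> \bar R) :
  (forall i, h i != -oo%E) -> (\sum_(i <- r) h i != -oo)%E.
Proof.
move=> hN; elim/big_ind : _ => // a b aN bN.
by rewrite adde_eq_ninfty negb_or aN.
Qed.

Lemma lower_semicontinuous_sum {R : realType} {T : topologicalType} {I : Type}
    (r : seq I) (h : I -> T -> \bar R) :
  (forall i x, h i x != -oo%E) -> (forall i, lower_semicontinuous (h i)) ->
  lower_semicontinuous (fun x => \sum_(i <- r) h i x)%E.
Proof.
move=> hN hlsc; elim: r => [|i r IH] x a.
  rewrite big_nil => a0; exists setT; first exact: filterT.
  by move=> y _; rewrite big_nil.
rewrite big_cons.
move=> /(lt_adde_split _ _ _ (hN _ _) (sume_neNy _ _ (hN^~ x)))[s [t [hs rt ast]]].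
have [V xV Vs] := hlsc _ _ _ hs; have [W xW Wt] := IH _ _ rt.
exists (V `&` W); first exact: filterI.
move=> y [/Vs sy /Wt ty]; rewrite big_cons.
by apply: lt_trans (lteD sy ty); rewrite -EFinD lte_fin.
Qed.

Section indicator.
Context {R : realType} {E : hilbertType R} (C : set E).

Lemma indicator_efun_ge0 x : (0 <= indicator_efun C x :> \bar R)%E.
Proof. by rewrite /indicator_efun; case: ifP. Qed.

Lemma lower_semicontinuous_indicator : closed C ->
  lower_semicontinuous (indicator_efun C).
Proof.
move=> cC x a; rewrite {1}/indicator_efun; case: ifPn => [_ a0|xC _].
  exists setT; first exact: filterT.
  by move=> y _; apply: lt_le_trans a0 (indicator_efun_ge0 y).
exists (~` C).
  by apply: open_nbhs_nbhs; split; [exact: closed_openC | rewrite notin_setE in xC].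
by move=> y /= yC; rewrite /indicator_efun memNset// ltry.
Qed.

Lemma convex_indicator :
  (forall x y (t : R), 0 < t < 1 -> C x -> C y -> C (t *: x + (1 - t) *: y)) ->
  convex_efun (indicator_efun C).
Proof.
move=> Cconv x y t t01; have /andP[t0 t1] := t01.
have s0 : 0 < 1 - t by rewrite subr_gt0.
have iN z : (-oo < indicator_efun C z)%E.
  by rewrite (lt_le_trans _ (indicator_efun_ge0 z)).
rewrite {2 3}/indicator_efun.
case: ifPn => [/set_mem xC|_].
  case: ifPn => [/set_mem yC|_].
    by rewrite !mule0 adde0 /indicator_efun mem_set//; exact: Cconv.
  by rewrite mule0 add0e gt0_muley ?lte_fin// leey.
rewrite gt0_muley ?lte_fin// addye ?leey// -ltNye.
case: ifP => _; first by rewrite mule0.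
by rewrite gt0_muley ?lte_fin.
Qed.

End indicator.

(** * Separable sums and the diagonal *)

Section product.
Context {R : realType} {X : hilbertType R} {m : nat}.

Lemma le_norm_coord (x : hpower m X) i : `|x i| <= `|x|.
Proof. exact: hpower_le_norm. Qed.

Lemma diagonal_spaceP (x : hpower m X) :
  diagonal_space x <-> forall i j, x i = x j.
Proof.
split=> [[c _ <-] i j|xc]; first by rewrite !ffunE.
have [[i]|no] := pselect (inhabited 'I_m).
  by exists (x i) => //; apply/ffunP => j; rewrite ffunE.
by exists 0 => //; apply/ffunP => j; exfalso; apply: no.
Qed.

(** If [x] has two coordinates at distance [d > 0], a diagonal point cannot be
    within [d / 2] of [x]: its common coordinate would be within [d / 2] of both. *)
Lemma closed_diagonal_space : closed (@diagonal_space R X m).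
Proof.
move=> x xcl; apply/diagonal_spaceP => i j; apply/eqP/negPn/negP => xij.
have e0 : 0 < `|x i - x j| / 2 by rewrite divr_gt0// normr_gt0 subr_eq0.
have [y [/diagonal_spaceP yc]] := xcl _ (nbhsx_ballx x _ e0).
rewrite -ball_normE /= => xy.
have xyk k : `|x k - y k| < `|x i - x j| / 2.
  by apply: le_lt_trans xy; have := le_norm_coord (x - y) k; rewrite !ffunE.
have := ler_normB (x i - y i) (x j - y j).
rewrite opprB addrA (yc j i) subrK.
move: (xyk i) (xyk j); rewrite (yc j i).
by move: `|x i - x j| `|_ - _| `|_ - _| => ? ? ?; lra.
Qed.

Lemma diagonal_space_comb (x y : hpower m X) (t : R) :
  diagonal_space x -> diagonal_space y ->
  diagonal_space (t *: x + (1 - t) *: y).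
Proof.
move=> /diagonal_spaceP xc /diagonal_spaceP yc; apply/diagonal_spaceP => i j.
by rewrite !ffunE (xc i j) (yc i j).
Qed.

Lemma diagonal_space0 : diagonal_space (0 : hpower m X).
Proof. by apply/diagonal_spaceP => i j; rewrite !ffunE. Qed.

Variable f : 'I_m -> X -> \bar R.
Hypothesis f_fin : forall i x, f i x != -oo%E.

Lemma lower_semicontinuous_separable_sum :
  (forall i, lower_semicontinuous (f i)) ->
  lower_semicontinuous (separable_sum f).
Proof.
move=> flsc; apply: lower_semicontinuous_sum => [i x|i x a /flsc[V]].
  exact: f_fin.
move=> /nbhs_ballP[e /= e0 eV] Vf.
exists (ball x e); first exact: nbhsx_ballx.
move=> y; rewrite -ball_normE /= => xy; apply/Vf/eV; rewrite -ball_normE /=.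
by apply: le_lt_trans xy; have := le_norm_coord (x - y) i; rewrite !ffunE.
Qed.

Lemma convex_separable_sum :
  (forall i, convex_efun (f i)) -> convex_efun (separable_sum f).
Proof.
move=> fconv x y t t01; rewrite /separable_sum.
have fdef (z : hpower m X) (i j : 'I_m) : (f i (z i) +? f j (z j))%E.
  by apply: ltninfty_adde_def; rewrite inE ltNye.
rewrite !fin_num_sume_distrr//.
rewrite -big_split; apply: lee_sum => i _.
by rewrite !ffunE; exact: fconv.
Qed.

Lemma separable_sum_le_coord (c : 'I_m -> R) (i : 'I_m) (x : hpower m X)
    (a : R) :
  (forall j y, (c j)%:E <= f j y)%E -> (separable_sum f x <= a%:E)%E ->
  (f i (x i) <= (a - \sum_(j | j != i) c j)%:E)%E.
Proof.
move=> fc; rewrite /separable_sum (bigD1 i)//= => fa.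
rewrite EFinB leeBrDr// -sumEFin.
by apply: le_trans fa; rewrite leeD2l// lee_sum.
Qed.

End product.

(** * Coercivity and the infimal convolution with the diagonal *)

Lemma coercive_sublevel_bounded {R : realType} {E : hilbertType R}
    (g : E -> \bar R) (a : R) : coercive_efun g ->
  exists r : R, forall x, (g x <= a%:E)%E -> `|x| <= r.
Proof.
move=> /(_ [set z | a%:E < z]%E (ereal_nbhs_pinfty_gt (num_real a)))[r _ rg].
exists r => x gxa; rewrite leNgt; apply/negP => /rg /=.
by rewrite ltNge gxa.
Qed.

Lemma bounded_below_of_inf {R : realType} {T : Type} (g : T -> \bar R) :
  (-oo < ereal_inf (range g))%E -> exists c : R, forall x, (c%:E <= g x)%E.
Proof.
have gx x : (ereal_inf (range g) <= g x)%E by apply: ereal_inf_lbound; exists x.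
case: ereal_inf gx => [c| |] // gx _; first by exists c.
by exists 0 => x; rewrite (le_trans _ (gx x))// leey.
Qed.

(** On the sublevel set the coercive coordinate [u i] is bounded. Since [x' - u] is
    constant, [u j = x' j - (x' i - u i)] is then bounded for every [j]. *)
Lemma separable_conv_bounded {R : realType} {X : hilbertType R} {m : nat}
    (f : 'I_m -> X -> \bar R) (c : 'I_m -> R) (i : 'I_m) :
  (forall j y, (c j)%:E <= f j y)%E -> coercive_efun (f i) ->
  forall (x : hpower m X) (a : R), exists B : R, forall x' u : hpower m X,
    `|x - x'| < 1 ->
    (separable_sum f u + indicator_efun diagonal_space (x' - u)%R <= a%:E)%E ->
    `|u| <= B.
Proof.
move=> fc fi x a.
have [r rP] := coercive_sublevel_bounded _ (a - \sum_(j | j != i) c j) fi.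
exists (Num.sqrt m%:R * (2 * (`|x| + 1) + r)) => x' u xx'.
have fN : (-oo < separable_sum f u)%E.
  rewrite ltNye; apply: sume_neNy => j.
  by rewrite -ltNye (lt_le_trans _ (fc _ _))// ltNyr.
rewrite /indicator_efun; case: ifPn => [/set_mem/diagonal_spaceP ud|_]; last first.
  by rewrite addey ?leye_eq// -ltNye.
rewrite adde0 => /(separable_sum_le_coord _ _ i _ _ fc)/rP ur.
have x'B : `|x'| <= `|x| + 1.
  have := ler_normB x (x - x'); rewrite subKr.
  by move: `|x'| `|x| `|x - x'| xx' => ? ? ?; lra.
have r0 : 0 <= r by exact: le_trans ur.
apply: hpower_norm_le => [|j]; first by rewrite addr_ge0// mulr_ge0// addr_ge0.
have := ud i j; rewrite !ffunE => uij.
have -> : u j = x' j - (x' i - u i) by rewrite uij subKr.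
have := ler_normB (x' j) (x' i - u i); have := ler_normB (x' i) (u i).
have := le_norm_coord x' i; have := le_norm_coord x' j.
move: `|x' j - _| `|x' i - u i| `|x' i| `|x' j| `|x'| `|x| `|u i| ur x'B.
by move=> ? ? ? ? ? ? ?; lra.
Qed.

Theorem proposition5p2 (R : realType) (X : hilbertType R) (m : nat)
    (f : 'I_m -> X -> \bar R) :
  (0 < m)%N ->
  (forall i, proper_efun (f i)) ->
  (forall i, lower_semicontinuous (f i)) ->
  (forall i, convex_efun (f i)) ->
  edom (fenchel_conjugate (separable_sum f)) `&` orthogonal_compl diagonal_space
    !=set0 ->
  (forall i, (-oo < ereal_inf (range (f i)))%E) ->
  (exists i, coercive_efun (f i)) ->
  [/\ proper_efun (inf_conv (separable_sum f) (indicator_efun diagonal_space)),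
      lower_semicontinuous (inf_conv (separable_sum f) (indicator_efun diagonal_space)),
      convex_efun (inf_conv (separable_sum f) (indicator_efun diagonal_space))
    & forall x, exact_at (separable_sum f) (indicator_efun diagonal_space) x].
Proof.
move=> _ fproper flsc fconv _ finf [i fi].
set F := separable_sum f; set D := indicator_efun diagonal_space.
have fN j y : f j y != -oo%E by exact: (fproper j).1.
have /choice[c fc] j : exists c : R, forall y, (c%:E <= f j y)%E.
  exact: bounded_below_of_inf.
have FN u : F u != -oo%E by exact: sume_neNy.
have DN u : D u != -oo%E.
  by rewrite -ltNye (lt_le_trans _ (indicator_efun_ge0 _ u)).
have Fconv : convex_efun F by exact: convex_separable_sum.
have Dconv : convex_efun D.
  by apply: convex_indicator => x y t _; exact: diagonal_space_comb.
have Flsc : lower_semicontinuous F by exact: lower_semicontinuous_separable_sum.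
have Dlsc : lower_semicontinuous D.
  exact/lower_semicontinuous_indicator/closed_diagonal_space.
have bnd := separable_conv_bounded f c i fc fi.
have FDN x : inf_conv F D x != -oo%E.
  rewrite -ltNye; apply: (@lt_le_trans _ _ (\sum_j c j)%:E); first exact: ltNyr.
  apply: le_ereal_inf_tmp => _ [u _ <-]; rewrite -[leLHS]adde0.
  by rewrite leeD ?indicator_efun_ge0// -sumEFin lee_sum.
split.
- split => //; have /choice[u uf] j : exists u, (f j u < +oo)%E := (fproper j).2.
  exists [ffun j => u j]; apply: le_lt_trans (inf_conv_le F D _ [ffun j => u j]) _.
  rewrite subrr /D /indicator_efun mem_set ?adde0; last exact: diagonal_space0.
  by apply: lte_sum_pinfty => j _; rewrite ffunE.
- exact: inf_conv_lsc.
- exact: inf_conv_convex.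
- by move=> x; exact: inf_conv_exact.
Qed.
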